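(* An element $A\in I_0$ is coherent if and only if $A$ is an orientation-preserving motion of the Euclidean plane.
   Context: For $t\in[-1,1]$ let $q_t:\mathbb{R}^3\to\mathbb{R}$ be the quadratic form $q_t(x,y,z)=tx^2+ty^2+z^2$. Let $J_t\subset \mathrm{GL}(3,\mathbb{R})$ be the subgroup of matrices preserving $q_t$ (that is, $q_t(Av)=q_t(v)$ for all $v\in\mathbb{R}^3$), and let $I_t$ be the connected component of the identity in $J_t$. In particular $$I_0=\{A=(A_{ij})\in \mathrm{GL}(3,\mathbb{R}) \mid A_{31}=A_{32}=0,\ A_{33}=1,\ \det(A)>0\}.$$ An element $A\in I_0$ is called coherent if for all $1\le i,j\le 3$ there exists a (real-)analytic function $t\mapsto A_{ij}(t)$ on $[-1,1]$ such that for each $t\in[-1,1]$ the matrix $A_t=(A_{ij}(t))$ belongs to $I_t$, and $A_0=A$. The group $I_0$ is identified with the group of orientation-preserving affine transformations of $\mathbb{R}^2$ in the usual way: the matrix $\begin{pmatrix} a&b&e\\ c&d&f\\ 0&0&1\end{pmatrix}$ acts on $\mathbb{R}^2$ by $(x,y)\mapsto(ax+by+e,\ cx+dy+f)$ (equivalently, by its action on the affine plane $z=1$). Saying that $A\in I_0$ is an orientation-preserving motion of the Euclidean plane means that this affine map is an orientation-preserving isometry of $\mathbb{R}^2$ with its standard Euclidean metric, i.e. that $\begin{pmatrix} a&b\\ c&d\end{pmatrix}\in \mathrm{SO}(2)$. *)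

(* Defs.v *)
From HB Require Import structures.
From mathcomp Require Import all_boot all_order all_algebra.
From mathcomp Require Import all_classical all_reals all_analysis.
Import Order.TTheory GRing.Theory Num.Theory.
Import numFieldNormedType.Exports.

Set Implicit Arguments.
Unset Strict Implicit.
Unset Printing Implicit Defensive.

Local Open Scope classical_set_scope.
Local Open Scope ring_scope.

(* The coordinates (x, y, z) are the entries of v with indices 0, 1, 2. *)
Definition qform (R : realType) (t : R) (v : 'cV[R]_3) : R :=
  t * v 0 0 ^+ 2 + t * v 1 0 ^+ 2 + v 2 0 ^+ 2.

Definition Jgroup (R : realType) (t : R) : set 'M[R]_3 :=
  [set A | A \in unitmx /\ forall v : 'cV[R]_3, qform t (A *m v) = qform t v].

(* 'M[R]_3 carries the product topology of R^9, and connectedness is intrinsic,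
   so this is also the component in the subspace topology of GL(3, R). *)
Definition Igroup (R : realType) (t : R) : set 'M[R]_3 :=
  connected_component (Jgroup t) 1%:M.

(* Real-analyticity on an interval D. At an endpoint belonging to D the
   expansion is one-sided; since a power series that converges on one side of
   its centre converges on the other side as well, for a nondegenerate closed
   interval this says that f extends to a real-analytic function on an open
   neighbourhood of D. *)
Definition analytic_on (R : realType) (D : set R) (f : R -> R) : Prop :=
  forall t0 : R, D t0 ->
    exists (a : nat -> R) (r : R), 0 < r /\
      forall t : R, D t -> `|t - t0| < r -> pseries a (t - t0) @ \oo --> f t.

Definition coherent (R : realType) (A : 'M[R]_3) : Prop :=
  exists F : 'I_3 -> 'I_3 -> R -> R,
    [/\ forall i j : 'I_3, analytic_on `[(-1)%R, 1%R] (F i j),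
        forall t : R, t \in `[(-1)%R, 1%R] -> Igroup t (\matrix_(i, j) F i j t)
      & \matrix_(i, j) F i j 0 = A].

(* For A = [a b e; c d f; 0 0 1], the blocks [a b; c d] and [e; f]. *)
Definition linear_part (R : realType) (A : 'M[R]_3) : 'M[R]_2 :=
  @ulsubmx R 2 1 2 1 A.

Definition translation_part (R : realType) (A : 'M[R]_3) : 'cV[R]_2 :=
  @ursubmx R 2 1 2 1 A.

Definition affine_action (R : realType) (A : 'M[R]_3) (p : 'cV[R]_2) : 'cV[R]_2 :=
  linear_part A *m p + translation_part A.

(* The library's norm on matrices is the sup norm, hence this definition. *)
Definition euclidean_dist (R : realType) (p q : 'cV[R]_2) : R :=
  Num.sqrt (\sum_(i < 2) (p i 0 - q i 0) ^+ 2).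

Definition euclidean_isometry (R : realType) (f : 'cV[R]_2 -> 'cV[R]_2) : Prop :=
  bijective f /\
  forall p q : 'cV[R]_2, euclidean_dist (f p) (f q) = euclidean_dist p q.

Definition orientation_preserving_motion (R : realType) (A : 'M[R]_3) : Prop :=
  euclidean_isometry (affine_action A) /\ 0 < \det (linear_part A).

(* Main.v *)
(* If A_t preserves q_t, A_0 = A and v is horizontal, write A_t v = (w_t, z_t);
   then t |w_t|^2 + z_t^2 = t |v|^2. As z_t is analytic and z_0 = 0, z_t^2 / t
   tends to 0 with t, so the linear part of A preserves the Euclidean norm; it
   preserves the orientation because I_0 is connected.

   Conversely, let A be the translation by (e, f) after a rotation B about the
   z-axis. Then B preserves every q_t, and the translation is the value at t = 0
   of the q_t-reflection in (0, 0, 1) followed by the one in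
   (g(t) e/2, g(t) f/2, 1), where g = (1 + t)^n. For n large this vector is
   q_t-positive for all t in [-1, 1], so the entries are rational functions of t
   without poles; scaling (e, f) and the angle of B down to 0 joins the product
   to the identity inside J_t. *)
Require Import Defs.
From mathcomp Require Import all_boot all_order all_algebra.
From mathcomp Require Import all_classical all_reals all_analysis.
From mathcomp Require Import ring lra.
Import Order.TTheory GRing.Theory Num.Theory.
Import numFieldNormedType.Exports.

Set Implicit Arguments.
Unset Strict Implicit.
Unset Printing Implicit Defensive.

Local Open Scope classical_set_scope.
Local Open Scope ring_scope.

(** * Power series near their centre *)

(** Convergence at [y] bounds the terms [a n * y ^+ n] by some [M]. For [x] at most half as large,
    the terms of positive index are dominated by a geometric series of ratio 1/2 with first term
    [M * |x| / |y|], so [C = 2 * M / |y|] works. *)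
Lemma pseries_dist_coef0 (R : realType) (a : R^nat) (y l : R) :
  y != 0 -> pseries a y @ \oo --> l ->
  exists2 C, 0 <= C & forall x m, `|x| <= `|y| / 2 ->
    pseries a x @ \oo --> m -> `|m - a 0%N| <= C * `|x|.
Proof.
move=> y0 ayl.
have yp : 0 < `|y| by rewrite normr_gt0.
have [M M0 aM] : exists2 M, 0 <= M & forall n, `|a n| * `|y| ^+ n <= M.
  have [M [_ /(_ (`|M| + 1)) aM]] : bounded_fun (fun n => a n * y ^+ n).
    apply: cvg_seq_bounded; apply/cvg_ex; exists 0; apply: cvg_series_cvg_0.
    by apply/cvg_ex; exists l.
  exists (`|M| + 1) => [|n]; first by rewrite addr_ge0.
  rewrite -normrX -normrM; apply: aM => //.
  by rewrite (le_lt_trans (ler_norm _))// ltrDl.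
exists (2 * M / `|y|) => [|x m xy axm]; first by rewrite divr_ge0 ?mulr_ge0.
(* The factor [1 - 2^-1 ^+ N], from the partial geometric sum, is what lets the induction close. *)
have tail N : `|\sum_(i < N) a i.+1 * x ^+ i.+1| <=
    2 * M / `|y| * `|x| * (1 - 2^-1 ^+ N).
  elim: N => [|N IH]; first by rewrite big_ord0 normr0 expr0 subrr mulr0.
  rewrite big_ord_recr /= (le_trans (ler_normD _ _))//.
  apply: (le_trans (lerD IH (lexx _))).
  suff : `|a N.+1 * x ^+ N.+1| <= M / `|y| * `|x| * 2^-1 ^+ N.
    rewrite (exprS 2^-1 N); set e := 2^-1 ^+ N; set b := M / `|y| * `|x| => h.
    rewrite (_ : 2 * M / `|y| * `|x| = 2 * b); last by rewrite /b !mulrA.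
    lra.
  have xN : `|x| ^+ N <= `|y| ^+ N * 2^-1 ^+ N.
    by rewrite -exprMn lerXn2r // nnegrE ?mulr_ge0.
  rewrite normrM normrX exprS.
  have -> : M / `|y| * `|x| * 2^-1 ^+ N = (M * `|x| * 2^-1 ^+ N) / `|y|.
    by field; rewrite gt_eqF.
  rewrite ler_pdivlMr//.
  apply: (@le_trans _ _ (`|a N.+1| * (`|x| * (`|y| ^+ N * 2^-1 ^+ N)) * `|y|)).
    by rewrite ler_wpM2r// ler_wpM2l// ler_wpM2l.
  have -> : `|a N.+1| * (`|x| * (`|y| ^+ N * 2^-1 ^+ N)) * `|y| =
     (`|a N.+1| * `|y| ^+ N.+1) * (`|x| * 2^-1 ^+ N) by rewrite exprS; ring.
  by rewrite -(mulrA M) ler_wpM2r// mulr_ge0// exprn_ge0.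
have : `|pseries a x n.+1 - a 0%N| @[n --> \oo] --> `|m - a 0%N|.
  apply: cvg_norm; apply: cvgB; last exact: cvg_cst.
  by rewrite (cvg_shiftS (pseries a x)).
move=> /cvgr_to_le; apply; apply: nearW => n.
rewrite /pseries /series /= big_mkord big_ord_recl /= expr0 mulr1 addrC addKr.
apply: (le_trans (tail n)).
by rewrite ler_piMr ?mulr_ge0 ?divr_ge0 ?mulr_ge0// gerBl exprn_ge0.
Qed.

(** This right-sided linear estimate at 0 is all that the forward implication takes from
    analyticity. *)
Lemma analytic_on_lipschitz0 (R : realType) (f : R -> R) :
  analytic_on `[(-1)%R, 1%R] f ->
  exists C r, 0 < r <= 1 /\ forall t, 0 < t <= r -> `|f t - f 0| <= C * t.
Proof.
move=> /(_ 0) []; first by rewrite /= in_itv /= lerN10 ler01.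
move=> a [r [r0 af]].
pose y := Num.min r 1 / 2.
have m0 : 0 < Num.min r 1 by rewrite lt_min r0 ltr01.
have y0 : 0 < y by rewrite divr_gt0.
have yr : y < r.
  by rewrite /y; have : Num.min r 1 <= r by [rewrite ge_min lexx]; lra.
have y1 : y <= 1.
  by rewrite /y; have : Num.min r 1 <= 1 by [rewrite ge_min lexx orbT]; lra.
have cva t : 0 <= t <= y -> pseries a t @ \oo --> f t.
  move=> /andP[t0 ty]; rewrite -{1}(subr0 t); apply: af.
    by rewrite /= in_itv /=; apply/andP; split; lra.
  by rewrite subr0 ger0_norm// (le_lt_trans ty).
have fa0 : f 0 = a 0%N.
  apply: (@cvg_unique R (@Rhausdorff R) (pseries a 0 @ \oo)).
    by apply: cva; rewrite lexx ltW.
  (* The partial sum of index 0 is empty; from index 1 on, the partial sums at 0 are constantly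
     [a 0]. *)
  rewrite /= -(cvg_shiftS (pseries a 0)).
  rewrite (_ : (fun n => _) = (fun=> a 0%N)); first exact: cvg_cst.
  apply/funext => n; rewrite /pseries /series /= big_mkord big_ord_recl /= expr0 mulr1.
  by rewrite big1 ?addr0// => i _; rewrite expr0n /= mulr0.
have [||C C0 H] := @pseries_dist_coef0 R a y (f y).
- by rewrite gt_eqF.
- by apply: cva; rewrite lexx ltW.
exists C, (y / 2); split => [|t /andP[t0 ty]]; first by apply/andP; split; lra.
rewrite fa0 -{2}(gtr0_norm t0); apply: H; first by rewrite !gtr0_norm.
by apply: cva; apply/andP; split; lra.
Qed.

(** * Analyticity of quotients of polynomials *)

(** The l1 norm of the coefficients. The cutoff [d] stays fixed during a division, since no
    remainder outgrows a common size bound of [p] and [q]. *)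
Definition polyl1 (R : realType) (d : nat) (p : {poly R}) : R := \sum_(i < d) `|p`_i|.

Lemma polyl1_ge0 (R : realType) d (p : {poly R}) : 0 <= polyl1 d p.
Proof. exact: sumr_ge0. Qed.

Lemma horner_le_polyl1 (R : realType) d (p : {poly R}) x :
  (size p <= d)%N -> `|x| <= 1 -> `|p.[x]| <= polyl1 d p.
Proof.
move=> pd x1; rewrite (horner_coef_wide _ pd) (le_trans (ler_norm_sum _ _ _))//.
by apply: ler_sum => i _; rewrite normrM normrX ler_piMr// exprn_ile1.
Qed.

Lemma polyl1_drop (R : realType) d (p : {poly R}) :
  (size p <= d)%N -> polyl1 d (drop_poly 1 p) <= polyl1 d p.
Proof.
move=> pd; rewrite /polyl1; case: d pd => [|d] pd; first by rewrite !big_ord0.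
rewrite big_ord_recr [leRHS]big_ord_recl /= addrC lerD//.
  by rewrite coef_drop_poly addn1 nth_default// normr0.
by apply: ler_sum => i _; rewrite coef_drop_poly addn1.
Qed.

Lemma polyl1B (R : realType) d (p q : {poly R}) :
  polyl1 d (p - q) <= polyl1 d p + polyl1 d q.
Proof. by rewrite -big_split /=; apply: ler_sum => i _; rewrite coefB ler_normB. Qed.

Lemma polyl1Z (R : realType) d c (p : {poly R}) :
  polyl1 d (c *: p) = `|c| * polyl1 d p.
Proof. by rewrite mulr_sumr; apply: eq_bigr => i _; rewrite coefZ normrM. Qed.

Lemma coef0_le_polyl1 (R : realType) d (p : {poly R}) :
  (size p <= d)%N -> `|p`_0| <= polyl1 d p.
Proof.
move=> pd; rewrite -horner_coef0; apply: horner_le_polyl1 => //.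
by rewrite normr0.
Qed.

(* Long division of p by q in increasing powers: the remainder after n steps is
   'X^n * (divrem p q n). *)
Fixpoint divrem (R : realType) (p q : {poly R}) n : {poly R} :=
  if n is m.+1 then
    drop_poly 1 (divrem p q m - ((divrem p q m)`_0 / q`_0) *: q)
  else p.

Lemma divremP (R : realType) (p q : {poly R}) n :
  q`_0 != 0 ->
  p = (\sum_(i < n) ((divrem p q i)`_0 / q`_0) *: 'X^i) * q
      + 'X^n * divrem p q n.
Proof.
move=> q0; elim: n => [|n {1}->]; first by rewrite big_ord0 mul0r add0r mul1r.
rewrite big_ord_recr /=; set r := divrem p q n; set c := _ / _.
(* The digit [c] cancels the constant coefficient of [r], so [r - c *: q] is divisible by ['X]. *)
have {1}-> : r = c *: q + 'X * drop_poly 1 (r - c *: q).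
  rewrite -[LHS](subrK (c *: q)) addrC; congr (_ + _).
  rewrite -{1}(poly_take_drop 1 (r - c *: q)) expr1 ['X * _]mulrC.
  rewrite [take_poly _ _](_ : _ = 0) ?add0r//; apply/polyP => i.
  rewrite coef_take_poly coef0; case: i => [|i]//=.
  by rewrite coefB coefZ /c divfK// subrr.
by rewrite exprSr -!mul_polyC; ring.
Qed.

Lemma size_divrem (R : realType) d (p q : {poly R}) n :
  (size p <= d)%N -> (size q <= d)%N ->
  (size (divrem p q n) <= d)%N.
Proof.
move=> pd qd; elim: n => [//|n IH] /=; rewrite size_drop_poly.
rewrite (leq_trans (leq_subr _ _))// (leq_trans (size_polyD _ _))//.
by rewrite geq_max IH size_polyN (leq_trans (size_scale_leq _ _)).
Qed.

(** One step subtracts [(r_0 / q_0) q] and shifts; as [|r_0|] is at most the norm of [r], the norm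
    grows by at most the stated factor. *)
Lemma polyl1_divrem (R : realType) d (p q : {poly R}) n :
  (size p <= d)%N -> (size q <= d)%N ->
  polyl1 d (divrem p q n) <= (1 + polyl1 d q / `|q`_0|) ^+ n * polyl1 d p.
Proof.
move=> pd qd; elim: n => [|n IH]; first by rewrite expr0 mul1r.
have rd := size_divrem n pd qd.
rewrite /=; set r := divrem p q n in rd IH *.
apply: (le_trans (polyl1_drop _)).
  rewrite (leq_trans (size_polyD _ _))// geq_max rd size_polyN.
  by rewrite (leq_trans (size_scale_leq _ _)).
apply: (le_trans (polyl1B _ _ _)); rewrite polyl1Z exprS -mulrA.
apply: (@le_trans _ _ ((1 + polyl1 d q / `|q`_0|) * polyl1 d r)).
  rewrite mulrDl mul1r lerD2l normrM normfV.
  rewrite (_ : _ / _ * _ = polyl1 d q / `|q`_0| * `|r`_0|); last by ring.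
  rewrite ler_wpM2l ?divr_ge0 ?polyl1_ge0//.
  exact: coef0_le_polyl1.
by rewrite ler_wpM2l// addr_ge0// divr_ge0// polyl1_ge0.
Qed.

(** The coefficients are the digits of the long division. The n-th partial sum misses [p / q] by
    [y ^+ n] times the n-th remainder over [q]; the remainders grow at most like [K ^+ n], so the
    error vanishes for [|y| < 1 / K]. *)
Lemma pseries_ratio (R : realType) (p q : {poly R}) :
  q`_0 != 0 ->
  exists (a : R^nat) (r : R), 0 < r /\
    forall y, `|y| < r -> q.[y] != 0 -> pseries a y @ \oo --> p.[y] / q.[y].
Proof.
move=> q0; pose d := maxn (size p) (size q).
have pd : (size p <= d)%N by exact: leq_maxl.
have qd : (size q <= d)%N by exact: leq_maxr.
pose K := 1 + polyl1 d q / `|q`_0|.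
have K1 : 1 <= K by rewrite lerDl divr_ge0 ?polyl1_ge0.
have K0 : 0 < K by exact: lt_le_trans K1.
exists (fun n => (divrem p q n)`_0 / q`_0), K^-1; split; first by rewrite invr_gt0.
move=> y yK qy; have y1 : `|y| <= 1.
  by rewrite (le_trans (ltW yK))// invf_le1.
have -> : pseries (fun n => (divrem p q n)`_0 / q`_0) y =
    (fun n => p.[y] / q.[y] - y ^+ n * (divrem p q n).[y] / q.[y]).
  apply/funext => n; rewrite /pseries /series /= big_mkord.
  have /(congr1 (fun s => s.[y])) := divremP p n q0.
  rewrite hornerD !hornerM hornerXn horner_sum => ->.
  under [in RHS]eq_bigr do rewrite hornerZ hornerXn.
  by field.
rewrite -[X in _ --> X]subr0; apply: cvgB; first exact: cvg_cst.
rewrite -(mul0r (q.[y])^-1); apply: cvgM; last exact: cvg_cst.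
apply/norm_cvg0P.
apply: (@squeeze_cvgr _ _ _ _ (fun=> 0) (geometric (polyl1 d p) (`|y| * K))).
- apply: nearW => n; rewrite normr_ge0 /= normrM normrX exprMn mulrCA.
  rewrite ler_wpM2l ?exprn_ge0//.
  rewrite (le_trans (horner_le_polyl1 (size_divrem n pd qd) y1))// mulrC.
  exact: polyl1_divrem.
- exact: cvg_cst.
- apply: cvg_geometric; rewrite ger0_norm ?mulr_ge0 ?(ltW K0)//.
  by rewrite -[ltRHS](@mulVf _ K) ?gt_eqF// ltr_pM2r.
Qed.

Lemma analytic_on_ratio (R : realType) (D : set R) (p q : {poly R}) :
  (forall t, D t -> q.[t] != 0) -> analytic_on D (fun t => p.[t] / q.[t]).
Proof.
move=> q0 t0 Dt0.
(* Recentring at [t0] reduces the claim to expansions at 0. *)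
have shiftE (s : {poly R}) t : (s \Po ('X + t0%:P)).[t - t0] = s.[t].
  by rewrite horner_comp !hornerE subrK.
have [|a [r [r0 H]]] := @pseries_ratio R (p \Po ('X + t0%:P)) (q \Po ('X + t0%:P)).
  by rewrite -horner_coef0 -[X in _.[X]](subrr t0) shiftE q0.
exists a, r; split => // t Dt tr.
by rewrite -!(shiftE _ t); apply: H => //; rewrite shiftE q0.
Qed.

(** * Coordinates, and the groups at t = 0 *)

Lemma sum2 (V : nmodType) (F : 'I_2 -> V) : \sum_i F i = F 0 + F 1.
Proof. by rewrite big_ord_recl big_ord1; congr (_ + F _); apply/val_inj. Qed.

Lemma sum3 (V : nmodType) (F : 'I_3 -> V) : \sum_i F i = F 0 + F 1 + F 2.
Proof.
rewrite !big_ord_recl big_ord0 addr0 addrA.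
by congr (_ + F _ + F _); apply/val_inj.
Qed.

Lemma forall3 (P : 'I_3 -> Prop) : P 0 -> P 1 -> P 2 -> forall i, P i.
Proof.
move=> P0 P1 P2 [[|[|[|//]]] i3].
- by rewrite (_ : Ordinal i3 = 0)//; apply/val_inj.
- by rewrite (_ : Ordinal i3 = 1)//; apply/val_inj.
- by rewrite (_ : Ordinal i3 = 2)//; apply/val_inj.
Qed.

Lemma det2 (R : comNzRingType) (M : 'M[R]_2) :
  \det M = M 0 0 * M 1 1 - M 0 1 * M 1 0.
Proof.
rewrite (expand_det_row _ 0) !big_ord_recl big_ord0 /cofactor !det_mx11 !mxE /=.
have l0 : lift 0 0 = 1 :> 'I_2 by apply/val_inj.
have l1 : lift 1 0 = 0 :> 'I_2 by apply/val_inj.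
by rewrite !l0 l1 /= expr0 expr1; ring.
Qed.

Lemma det3 (R : comNzRingType) (M : 'M[R]_3) : \det M =
  M 2 0 * (M 0 1 * M 1 2 - M 0 2 * M 1 1)
  - M 2 1 * (M 0 0 * M 1 2 - M 0 2 * M 1 0)
  + M 2 2 * (M 0 0 * M 1 1 - M 0 1 * M 1 0).
Proof.
rewrite (expand_det_row _ 2) sum3 /cofactor !det2 !mxE.
have -> : lift 2 0 = 0 :> 'I_3 by apply/val_inj.
have -> : lift 2 1 = 1 :> 'I_3 by apply/val_inj.
have -> : lift 0 0 = 1 :> 'I_3 by apply/val_inj.
have -> : lift 0 1 = 2 :> 'I_3 by apply/val_inj.
have -> : lift 1 0 = 0 :> 'I_3 by apply/val_inj.
have -> : lift 1 1 = 2 :> 'I_3 by apply/val_inj.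
by rewrite /= addn0; ring.
Qed.

Lemma qform_mulmx (R : realType) t (M : 'M[R]_3) (v : 'cV[R]_3) :
  qform t (M *m v) =
    t * (M 0 0 * v 0 0 + M 0 1 * v 1 0 + M 0 2 * v 2 0) ^+ 2
    + t * (M 1 0 * v 0 0 + M 1 1 * v 1 0 + M 1 2 * v 2 0) ^+ 2
    + (M 2 0 * v 0 0 + M 2 1 * v 1 0 + M 2 2 * v 2 0) ^+ 2.
Proof. by rewrite /qform !mxE !sum3. Qed.

Lemma Jgroup_coord (R : realType) t (M : 'M[R]_3) (x y z : R) : Jgroup t M ->
    t * (M 0 0 * x + M 0 1 * y + M 0 2 * z) ^+ 2
    + t * (M 1 0 * x + M 1 1 * y + M 1 2 * z) ^+ 2
    + (M 2 0 * x + M 2 1 * y + M 2 2 * z) ^+ 2 =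
  t * x ^+ 2 + t * y ^+ 2 + z ^+ 2.
Proof.
move=> [_ /(_ (\col_i nth 0 [:: x; y; z] i))].
by rewrite qform_mulmx /qform !mxE.
Qed.

(** By the intermediate value theorem, [phi] would otherwise vanish somewhere on a connected part of
    [Jgroup t] that contains the identity. *)
Lemma Igroup_pos (R : realType) t (phi : 'M[R]_3 -> R) (A : 'M[R]_3) :
  continuous phi -> (forall M, Jgroup t M -> phi M != 0) -> 0 < phi 1%:M ->
  Igroup t A -> 0 < phi A.
Proof.
move=> phic phi0 phi1 [C [C1 CJ Cc] CA].
have /connected_intervalP itv : connected (phi @` C).
  by apply: connected_continuous_connected => //; exact: continuous_subspaceT.
rewrite ltNge; apply/negP => phiA.
have [M CM phiM] : (phi @` C) 0.
  apply: (itv (phi A) (phi 1%:M)); [by exists A|by exists 1%:M|].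
  by rewrite phiA ltW.
by have := phi0 _ (CJ _ CM); rewrite phiM eqxx.
Qed.

(** For t = 0 the form is z^2, so the basis vectors give the squares of the entries in the last
    row. *)
Lemma Jgroup0 (R : realType) (M : 'M[R]_3) : Jgroup 0 M ->
  [/\ M 2 0 = 0, M 2 1 = 0, M 2 2 != 0, M 2 2 ^+ 2 = 1
    & M 0 0 * M 1 1 - M 0 1 * M 1 0 != 0].
Proof.
move=> JM; have H x y z := Jgroup_coord x y z JM.
have M20 : M 2 0 = 0.
  by apply/eqP; rewrite -sqrf_eq0; apply/eqP; have := H 1 0 0; lra.
have M21 : M 2 1 = 0.
  by apply/eqP; rewrite -sqrf_eq0; apply/eqP; have := H 0 1 0; lra.
have M22 : M 2 2 ^+ 2 = 1 by have := H 0 0 1; lra.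
split => //; first by rewrite -sqrf_eq0 M22 oner_eq0.
have [+ _] := JM; rewrite unitmxE unitfE det3 M20 M21 !mul0r subr0 add0r.
by rewrite mulf_eq0 negb_or => /andP[].
Qed.

(** Neither the corner entry nor the determinant of the linear block vanishes on [Jgroup 0], so both
    keep their sign at the identity. *)
Lemma Igroup0 (R : realType) (A : 'M[R]_3) : Igroup 0 A ->
  [/\ A 2 0 = 0, A 2 1 = 0, A 2 2 = 1 & 0 < A 0 0 * A 1 1 - A 0 1 * A 1 0].
Proof.
move=> IA.
have [A20 A21 _ A22 _] := Jgroup0 (connected_component_sub IA).
have A22p : 0 < A 2 2.
  apply: (@Igroup_pos _ 0 (fun M => M 2 2)) => //.
  - by move=> M; apply: coord_continuous.
  - by move=> M /Jgroup0[].
  - by rewrite mxE.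
split => //; first by nra.
apply: (@Igroup_pos _ 0 (fun M => M 0 0 * M 1 1 - M 0 1 * M 1 0)) => //.
- move=> M; have c i j := @coord_continuous R 3 3 i j M.
  exact: (cvgB (cvgM (c 0 0) (c 1 1)) (cvgM (c 0 1) (c 1 0))).
- by move=> M /Jgroup0[].
- by rewrite !mxE /= mulr0 subr0 mulr1 ltr01.
Qed.

(** * Motions of the Euclidean plane in coordinates *)

(** The columns are orthonormal, so Lagrange's identity makes the determinant 1; then
    [(a - d) ^+ 2 + (b + c) ^+ 2], which is 2 minus twice the determinant, vanishes. *)
Lemma rotation_of_isometry (R : realFieldType) (a b c d : R) :
  (forall x y, (a * x + b * y) ^+ 2 + (c * x + d * y) ^+ 2 = x ^+ 2 + y ^+ 2) ->
  0 < a * d - b * c -> [/\ d = a, b = - c & a ^+ 2 + c ^+ 2 = 1].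
Proof.
move=> H det0.
have ac : a ^+ 2 + c ^+ 2 = 1 by have := H 1 0; lra.
have bd : b ^+ 2 + d ^+ 2 = 1 by have := H 0 1; lra.
have abcd : a * b + c * d = 0 by have := H 1 1; nra.
have det1 : a * d - b * c = 1.
  have : (a * d - b * c) ^+ 2 = 1.
    have -> : (a * d - b * c) ^+ 2 =
      (a ^+ 2 + c ^+ 2) * (b ^+ 2 + d ^+ 2) - (a * b + c * d) ^+ 2 by ring.
    by rewrite ac bd abcd; ring.
  by nra.
have : (a - d) ^+ 2 + (b + c) ^+ 2 = 0 by nra.
move/eqP; rewrite paddr_eq0 ?sqr_ge0// !sqrf_eq0 subr_eq0 addr_eq0.
by move=> /andP[/eqP ad /eqP bc]; split.
Qed.

Lemma linear_partE (R : realType) (A : 'M[R]_3) :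
  [/\ linear_part A 0 0 = A 0 0, linear_part A 0 1 = A 0 1,
      linear_part A 1 0 = A 1 0 & linear_part A 1 1 = A 1 1].
Proof.
by split; rewrite /linear_part !mxE; congr (A _ _); apply/val_inj.
Qed.

Lemma euclidean_dist_affine (R : realType) (A : 'M[R]_3) (p q : 'cV[R]_2) :
  let x := p 0 0 - q 0 0 in let y := p 1 0 - q 1 0 in
  euclidean_dist (affine_action A p) (affine_action A q) =
  Num.sqrt ((A 0 0 * x + A 0 1 * y) ^+ 2 + (A 1 0 * x + A 1 1 * y) ^+ 2).
Proof.
move=> x y; have [A00 A01 A10 A11] := linear_partE A.
have E r i : affine_action A r i 0 =
    linear_part A i 0 * r 0 0 + linear_part A i 1 * r 1 0 + translation_part A i 0.
  by rewrite /affine_action mxE; congr (_ + _); rewrite mxE sum2.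
rewrite /euclidean_dist sum2 !E A00 A01 A10 A11 /x /y; congr Num.sqrt.
by ring.
Qed.

Lemma orientation_preserving_motionP (R : realType) (A : 'M[R]_3) :
  orientation_preserving_motion A <->
  [/\ A 1 1 = A 0 0, A 0 1 = - A 1 0 & A 0 0 ^+ 2 + A 1 0 ^+ 2 = 1].
Proof.
have distE (p q : 'cV[R]_2) : euclidean_dist p q =
    Num.sqrt ((p 0 0 - q 0 0) ^+ 2 + (p 1 0 - q 1 0) ^+ 2).
  by rewrite /euclidean_dist sum2.
have detE : \det (linear_part A) = A 0 0 * A 1 1 - A 0 1 * A 1 0.
  by have [A00 A01 A10 A11] := linear_partE A; rewrite det2 A00 A01 A10 A11.
rewrite /orientation_preserving_motion detE; split.
  move=> [[_ iso] det0]; apply: rotation_of_isometry => // x y.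
  have := iso (\col_i nth 0 [:: x; y] i) 0.
  rewrite euclidean_dist_affine distE !mxE /= !subr0.
  by move=> /eqP; rewrite eqr_sqrt ?addr_ge0 ?sqr_ge0// => /eqP.
move=> [A11 A01 AA].
have det1 : A 0 0 * A 1 1 - A 0 1 * A 1 0 = 1 by rewrite -AA A11 A01; ring.
rewrite det1; split => //; split; last first.
  move=> p q; rewrite euclidean_dist_affine distE; congr Num.sqrt.
  set x := p 0 0 - _; set y := p 1 0 - _.
  by rewrite -[RHS]mul1r -AA A11 A01; ring.
have Lu : linear_part A \in unitmx by rewrite unitmxE detE det1 unitr1.
exists (fun p => invmx (linear_part A) *m (p - translation_part A)) => p.
  by rewrite /affine_action addrK mulKmx.
by rewrite /affine_action mulKVmx// subrK.
Qed.

(** * Coherent elements are motions *)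

(** Dividing the identity by [t] leaves [f ^+ 2 + g ^+ 2 - m = - h ^+ 2 / t], which is at most
    [C ^+ 2 * t] in absolute value because [h 0 = 0]. Uniqueness of the limit from the right
    concludes. *)
Lemma degenerate_limit (R : realType) (f g h : R -> R) (m C r : R) :
  0 < r -> h 0 = 0 ->
  (forall t, 0 < t <= r ->
    [/\ `|f t - f 0| <= C * t, `|g t - g 0| <= C * t & `|h t - h 0| <= C * t]) ->
  (forall t, 0 < t <= r -> t * f t ^+ 2 + t * g t ^+ 2 + h t ^+ 2 = t * m) ->
  f 0 ^+ 2 + g 0 ^+ 2 = m.
Proof.
move=> r0 h0 lip fgh.
have near0r : \forall t \near 0^'+, 0 < t <= r.
  near=> t; apply/andP; split; near: t; first exact: nbhs_right_gt.
  exact: nbhs_right_le.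
have lin0 (c : R) : c * t @[t --> 0^'+] --> 0.
  rewrite -[X in _ --> X](mulr0 c); apply: cvgM; first exact: cvg_cst.
  exact: cvg_at_right_filter cvg_id.
have cvgl (k : R -> R) : (forall t, 0 < t <= r -> `|k t - k 0| <= C * t) ->
    k t @[t --> 0^'+] --> k 0.
  move=> kC; apply/subr_cvg0/norm_cvg0P.
  apply: (squeeze_cvgr _ (cvg_cst 0) (lin0 C)).
  by near=> t; rewrite normr_ge0 kC//; near: t.
have cvg1 : f t ^+ 2 + g t ^+ 2 @[t --> 0^'+] --> f 0 ^+ 2 + g 0 ^+ 2.
  apply: cvgD; apply: cvgM; apply: cvgl => t tr; by have [] := lip t tr.
have cvg2 : f t ^+ 2 + g t ^+ 2 @[t --> 0^'+] --> m.
  apply/subr_cvg0/norm_cvg0P.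
  apply: (squeeze_cvgr _ (cvg_cst 0) (lin0 (C ^+ 2))).
  near=> t; rewrite normr_ge0 /=.
  have tr : 0 < t <= r by near: t.
  have [_ _] := lip t tr; rewrite h0 subr0 => hC.
  have /andP[t0 _] := tr.
  have hC2 : h t ^+ 2 <= (C * t) ^+ 2.
    by rewrite -real_normK ?num_real// lerXn2r// ?nnegrE// (le_trans _ hC).
  have -> : f t ^+ 2 + g t ^+ 2 - m = - (h t ^+ 2 / t).
    apply: (mulfI (lt0r_neq0 t0)).
    rewrite mulrN mulrCA divff ?lt0r_neq0// mulr1.
    by have := fgh t tr; rewrite -mulrDr mulrBr; lra.
  rewrite normrN ger0_norm ?divr_ge0 ?sqr_ge0 ?(ltW t0)//.
  by rewrite ler_pdivrMr// -mulrA -expr2 -exprMn.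
exact: (cvg_unique _ cvg1 cvg2).
Unshelve. all: by end_near. Qed.

Lemma coherent_motion (R : realType) (A : 'M[R]_3) :
  Igroup 0 A -> coherent A -> orientation_preserving_motion A.
Proof.
move=> IA [F [Fan FI FA]].
have [A20 A21 _ det0] := Igroup0 IA.
have F0 i j : F i j 0 = A i j by rewrite -FA mxE.
(* One constant and one radius for all nine entries: the sum of the constants and the minimum of the
   radii. *)
have [C [r [r0 r1 lip]]] : exists C r, [/\ 0 < r, r <= 1 &
    forall i j t, 0 < t <= r -> `|F i j t - F i j 0| <= C * t].
  have /choice[Cr HCr] : forall ij : 'I_3 * 'I_3, exists Cr : R * R,
      0 < Cr.2 <= 1 /\ forall t, 0 < t <= Cr.2 ->
        `|F ij.1 ij.2 t - F ij.1 ij.2 0| <= Cr.1 * t.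
    by move=> [i j]; have [C [r H]] := analytic_on_lipschitz0 (Fan i j); exists (C, r).
  exists (\sum_ij `|(Cr ij).1|), (\big[Order.min/1]_ij (Cr ij).2); split.
  - by apply: lt_bigmin => // ij _; have [/andP[]] := HCr ij.
  - exact: bigmin_le_id.
  - move=> i j t /andP[t0 tr]; have [_ H] := HCr (i, j).
    apply: (le_trans (H t _)).
      by rewrite t0 (le_trans tr)//; exact: bigmin_le_cond.
    rewrite ler_wpM2r ?(ltW t0)// (le_trans (ler_norm _))//.
    by rewrite (bigD1 (i, j))//= lerDl sumr_ge0.
apply/orientation_preserving_motionP/rotation_of_isometry => // x y.
rewrite -!F0.
apply: (@degenerate_limit R (fun t => F 0 0 t * x + F 0 1 t * y)
  (fun t => F 1 0 t * x + F 1 1 t * y) (fun t => F 2 0 t * x + F 2 1 t * y)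
  _ (C * (`|x| + `|y|)) r) => //.
- by rewrite !F0 A20 A21; ring.
- move=> t tr; have lipxy i :
      `|F i 0 t * x + F i 1 t * y - (F i 0 0 * x + F i 1 0 * y)|
      <= C * (`|x| + `|y|) * t.
    have -> : F i 0 t * x + F i 1 t * y - (F i 0 0 * x + F i 1 0 * y) =
      (F i 0 t - F i 0 0) * x + (F i 1 t - F i 1 0) * y by ring.
    rewrite (le_trans (ler_normD _ _))// !normrM.
    rewrite mulrAC mulrDr lerD// ler_wpM2r//; exact: lip.
  by split.
- move=> t /andP[t0 tr].
  have /FI/connected_component_sub/Jgroup_coord Ht : t \in `[(-1)%R, 1%R].
    by rewrite in_itv /=; apply/andP; split; lra.
  by have := Ht x y 0; rewrite !mxE !mulr0 !addr0 expr0n /= addr0 mulrDr => ->.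
Qed.

(** * The deformation and its path to the identity *)

Lemma continuous_mx (R : realType) (T : topologicalType) m n (f : T -> 'M[R]_(m, n)) :
  (forall i j, continuous (fun x => f x i j)) -> continuous f.
Proof.
move=> fc x; apply/cvg_mx_entourageP => U entU.
apply: filter_forall => i; apply: filter_forall => j.
have /cvg_entourageP/(_ _ entU) H := fc i j x.
near do rewrite inE.
exact: H.
Unshelve. all: by end_near.
Qed.

(* The product T *m B, where B is the rotation with first column (a, c, 0) and,
   writing e3 for the last basis vector, T is the product of the q_t-reflection
   in e3 with the q_t-reflection in (p, q, 1); T has the entries below for
   (a, c) = (1, 0). Both are defined whenever 1 + t * (p ^ 2 + q ^ 2) <> 0, and
   T is the translation by (2 p, 2 q) for t = 0. *)
Definition deform_entries (R : realType) (t p q a c : R) : seq (seq R) :=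
  let D := 1 + t * (p ^+ 2 + q ^+ 2) in
  let m := a * p + c * q in
  let n := a * q - c * p in
  [:: [:: a - 2 * t * m * p / D; - c - 2 * t * n * p / D; 2 * p / D];
      [:: c - 2 * t * m * q / D; a - 2 * t * n * q / D; 2 * q / D];
      [:: - (2 * t * m / D); - (2 * t * n / D);
          1 - 2 * t * (p ^+ 2 + q ^+ 2) / D]].

Definition deform (R : realType) (t p q a c : R) : 'M[R]_3 :=
  \matrix_(i, j) nth 0 (nth [::] (deform_entries t p q a c) i) j.

Lemma deform_Jgroup (R : realType) (t p q a c : R) :
  1 + t * (p ^+ 2 + q ^+ 2) != 0 -> a ^+ 2 + c ^+ 2 = 1 ->
  Jgroup t (deform t p q a c).
Proof.
move=> D0 ac; split.
  rewrite unitmxE unitfE det3 !mxE /=.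
  rewrite [X in X != 0](_ : _ = a ^+ 2 + c ^+ 2); first by rewrite ac oner_neq0.
  by field.
move=> v; rewrite qform_mulmx !mxE /= /qform.
set x := v 0 0; set y := v 1 0; set z := v 2 0.
(* Inserting [a ^+ 2 + c ^+ 2] turns the goal into an identity of rational functions that holds for
   all [a] and [c]. *)
have -> : t * x ^+ 2 + t * y ^+ 2 + z ^+ 2 =
  (a ^+ 2 + c ^+ 2) * (t * x ^+ 2 + t * y ^+ 2) + z ^+ 2 by rewrite ac; ring.
by field.
Qed.

Lemma deform1 (R : realType) (t : R) : deform t 0 0 1 0 = 1%:M.
Proof.
apply/matrixP; apply: forall3; apply: forall3; rewrite !mxE /=; by ring.
Qed.

Lemma cos_sin_ex (R : realType) (a c : R) :
  a ^+ 2 + c ^+ 2 = 1 -> exists th, cos th = a /\ sin th = c.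
Proof.
move=> ac; have a1 : -1 <= a <= 1 by apply/andP; split; nra.
have ca : cos (acos a) = a by rewrite acosK// in_itv.
have := sin_acos a1; rewrite (_ : 1 - _ = c ^+ 2); last by lra.
rewrite sqrtr_sqr; case: (ger0P c) => _ sa.
  by exists (acos a).
(* [acos] only yields angles with nonnegative sine. *)
by exists (- acos a); rewrite cosN sinN ca sa opprK.
Qed.

Lemma deform_Igroup (R : realType) (t p q a c : R) :
  -1 < t * (p ^+ 2 + q ^+ 2) -> a ^+ 2 + c ^+ 2 = 1 ->
  Igroup t (deform t p q a c).
Proof.
move=> tpq /cos_sin_ex[th [<- <-]].
(* The scaling factor [sin s] is 0 at [s = 0] and 1 at [pi / 2], and its square never exceeds 1. The
   path is thus defined on the whole line, which is connected, and [D0] shows that it meets no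
   pole. *)
pose f s := deform t (sin s * p) (sin s * q) (cos (sin s * th)) (sin (sin s * th)).
have D0 s : 1 + t * ((sin s * p) ^+ 2 + (sin s * q) ^+ 2) != 0.
  rewrite !exprMn -mulrDr mulrCA lt0r_neq0//.
  have s0 := sqr_ge0 (sin s).
  have s1 : sin s ^+ 2 <= 1 by have := sin2cos2 s; have := sqr_ge0 (cos s); lra.
  have [h0|h0] := leP 0 (t * (p ^+ 2 + q ^+ 2)).
    by rewrite ltr_pwDl// mulr_ge0.
  have := ler_wnM2r (ltW h0) s1; lra.
have fE : f (pi / 2) = deform t p q (cos th) (sin th).
  by rewrite /f sin_pihalf !mul1r.
have f0 : f 0 = 1%:M by rewrite /f sin0 !mul0r cos0 sin0 deform1.
apply: (@connected_component_max _ _ (range f)); last by exists (pi / 2).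
- by exists 0.
- by move=> _ [s _ <-]; apply: deform_Jgroup => //; exact: cos2Dsin2.
apply: connected_continuous_connected; first exact/connected_intervalP.
apply: continuous_subspaceT; apply: continuous_mx => i j.
rewrite (_ : (fun s => f s i j) = fun s => nth 0 (nth [::] (deform_entries t
    (sin s * p) (sin s * q) (cos (sin s * th)) (sin (sin s * th))) i) j); last first.
  by apply/funext => s; rewrite mxE.
move=> s.
have cst k : {for s, continuous (fun=> k : R)} by exact: cvg_cst.
have cB (u v : R -> R) : {for s, continuous u} -> {for s, continuous v} ->
  {for s, continuous (fun x => u x - v x)} by exact: cvgB.
have cN (u : R -> R) : {for s, continuous u} ->
  {for s, continuous (fun x => - u x)} by exact: cvgN.
have cM (u v : R -> R) : {for s, continuous u} -> {for s, continuous v} ->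
  {for s, continuous (fun x => u x * v x)} by exact: cvgM.
have csM k : {for s, continuous (fun x => sin x * k : R)}.
  by apply: cM => //; exact: continuous_sin.
have ccos : {for s, continuous (fun x => cos (sin x * th))}.
  by apply: continuous_comp => //; exact: continuous_cos.
have csin : {for s, continuous (fun x => sin (sin x * th))}.
  by apply: continuous_comp => //; exact: continuous_sin.
have cs2 : {for s, continuous (fun x => (sin x * p) ^+ 2 + (sin x * q) ^+ 2)}.
  by apply: cvgD; apply: cM.
have cD : {for s, continuous
    (fun x => (1 + t * ((sin x * p) ^+ 2 + (sin x * q) ^+ 2))^-1)}.
  apply: cvgV => //; apply: cvgD; [exact: cst|exact: cM].
have cm : {for s, continuous (fun x =>
    cos (sin x * th) * (sin x * p) + sin (sin x * th) * (sin x * q))}.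
  by apply: cvgD; apply: cM.
have cn : {for s, continuous (fun x =>
    cos (sin x * th) * (sin x * q) - sin (sin x * th) * (sin x * p))}.
  by apply: cB; apply: cM.
have cq (u v : R -> R) : {for s, continuous u} -> {for s, continuous v} ->
    {for s, continuous (fun x => 2 * t * u x * v x /
      (1 + t * ((sin x * p) ^+ 2 + (sin x * q) ^+ 2)))}.
  by move=> cu cv; exact: cM (cM _ _ (cM _ _ (cst _) cu) cv) cD.
move: i j; apply: forall3; apply: forall3 => /=.
- exact: cB ccos (cq _ _ cm (csM p)).
- exact: cB (cN _ csin) (cq _ _ cn (csM p)).
- exact: cM (cM _ _ (cst 2) (csM p)) cD.
- exact: cB csin (cq _ _ cm (csM q)).
- exact: cB ccos (cq _ _ cn (csM q)).
- exact: cM (cM _ _ (cst 2) (csM q)) cD.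
- exact: cN (cM _ _ (cM _ _ (cst _) cm) cD).
- exact: cN (cM _ _ (cM _ _ (cst _) cn) cD).
- exact: cB (cst 1) (cM _ _ (cM _ _ (cst _) cs2) cD).
Qed.

(** * Motions are coherent *)

(** A form of Bernoulli's inequality; the induction rests on
    [(1 - x) * (1 + (n + 1) * x) <= 1 + n * x]. *)
Lemma expr1B_le (R : realFieldType) (x : R) n :
  0 <= x <= 1 -> (1 - x) ^+ n * (1 + n%:R * x) <= 1.
Proof.
move=> /andP[x0 x1]; elim: n => [|n IH]; first by rewrite expr0 mul0r addr0 mul1r.
apply: le_trans IH; rewrite exprSr -mulrA ler_wpM2l ?exprn_ge0 ?subr_ge0//.
rewrite -natr1; have : 0 <= (n%:R : R) by rewrite ler0n.
by nra.
Qed.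

(* For t < 0 the vectors (p, q, 1) of the reflections defining deform stay away
   from the light cone of q_t only if (p, q) is small; the factor (1 + t) ^ n,
   equal to 1 at t = 0, ensures this. *)
Lemma damping_ex (R : realType) (h : R) : 0 <= h ->
  exists n, forall t, -1 <= t <= 1 -> -1 < t * ((1 + t) ^+ n) ^+ 2 * h.
Proof.
move=> h0; exists (Num.bound h) => t /andP[t1 t2]; set n := Num.bound h.
have hn : h < n%:R by exact: archi_boundP.
have [t0|t0] := leP 0 t.
  by rewrite (lt_le_trans (ltrN10 R))// mulr_ge0// mulr_ge0// sqr_ge0.
have t01 : 0 <= - t <= 1 by apply/andP; split; lra.
(* With [x = - t] and exponent [2 * n] this gives [E * (1 + 2 * n * (- t)) <= 1]. Since [h < n], the
   product [- t * E * h] is then at most 1/2. *)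
have := expr1B_le (n * 2) t01; rewrite opprK exprM natrM.
set E := (_ ^+ n) ^+ 2.
move=> H; have E0 : 0 <= E by exact: sqr_ge0.
have [->|E0'] := eqVneq E 0; first by rewrite mulr0 mul0r ltrN10.
have Ep : 0 < E by rewrite lt0r E0'.
have : 0 <= (n%:R - h) * (- t * E).
  by rewrite mulr_ge0 ?subr_ge0 ?(ltW hn)// mulr_ge0// oppr_ge0 ltW.
by lra.
Qed.

Lemma analytic_on_ext (R : realType) (D : set R) (f g : R -> R) :
  (forall t, D t -> f t = g t) -> analytic_on D f -> analytic_on D g.
Proof.
move=> fg fan t0 /fan[a [r [r0 H]]]; exists a, r; split=> // t Dt.
by rewrite -fg//; exact: H.
Qed.

Lemma deform_analytic (R : realType) (D : set R) (g : {poly R}) (p q a c : R)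
    (i j : 'I_3) :
  (forall t, D t -> 1 + t * ((g.[t] * p) ^+ 2 + (g.[t] * q) ^+ 2) != 0) ->
  analytic_on D (fun t => deform t (g.[t] * p) (g.[t] * q) a c i j).
Proof.
move=> D0.
have [den denE] : exists den : {poly R}, forall t,
    den.[t] = 1 + t * ((g.[t] * p) ^+ 2 + (g.[t] * q) ^+ 2).
  by exists (1 + 'X * ((g * p%:P) ^+ 2 + (g * q%:P) ^+ 2)) => t; rewrite !hornerE.
(* Over the common denominator, all nine entries have a numerator of this shape, with constants [u],
   [v], [w], [x]. *)
suff [u [v [w [x uvwx]]]] : exists u v w x, forall t, D t ->
    (u%:P * den + v%:P * 'X * g ^+ 2 + w%:P * g + x%:P * 'X * g).[t] / den.[t] =
    deform t (g.[t] * p) (g.[t] * q) a c i j.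
  apply: (analytic_on_ext uvwx); apply: analytic_on_ratio => t Dt.
  by rewrite denE D0.
pose m := a * p + c * q; pose n := a * q - c * p.
move: i j; apply: forall3; apply: forall3.
- exists a, (- 2 * m * p), 0, 0 => t Dt; rewrite !hornerE denE mxE /= /m.
  by field; exact: D0.
- exists (- c), (- 2 * n * p), 0, 0 => t Dt; rewrite !hornerE denE mxE /= /n.
  by field; exact: D0.
- exists 0, 0, (2 * p), 0 => t Dt; rewrite !hornerE denE mxE /=.
  by field; exact: D0.
- exists c, (- 2 * m * q), 0, 0 => t Dt; rewrite !hornerE denE mxE /= /m.
  by field; exact: D0.
- exists a, (- 2 * n * q), 0, 0 => t Dt; rewrite !hornerE denE mxE /= /n.
  by field; exact: D0.
- exists 0, 0, (2 * q), 0 => t Dt; rewrite !hornerE denE mxE /=.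
  by field; exact: D0.
- exists 0, 0, 0, (- 2 * m) => t Dt; rewrite !hornerE denE mxE /= /m.
  by field; exact: D0.
- exists 0, 0, 0, (- 2 * n) => t Dt; rewrite !hornerE denE mxE /= /n.
  by field; exact: D0.
- exists 1, (- 2 * (p ^+ 2 + q ^+ 2)), 0, 0 => t Dt; rewrite !hornerE denE mxE /=.
  by field; exact: D0.
Qed.

Lemma motion_coherent (R : realType) (A : 'M[R]_3) :
  Igroup 0 A -> orientation_preserving_motion A -> coherent A.
Proof.
move=> /Igroup0[A20 A21 A22 _] /orientation_preserving_motionP[A11 A01 AA].
have [n Hn] := @damping_ex R ((A 0 2 / 2) ^+ 2 + (A 1 2 / 2) ^+ 2)
  (addr_ge0 (sqr_ge0 _) (sqr_ge0 _)).
pose g : {poly R} := (1 + 'X) ^+ n.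
(* Halved, because at t = 0 the deformation translates by [(2 p, 2 q)]. *)
pose p := A 0 2 / 2; pose q := A 1 2 / 2.
have gE t : g.[t] = (1 + t) ^+ n by rewrite !hornerE.
have D0 t : t \in `[(-1)%R, 1%R] ->
    -1 < t * ((g.[t] * p) ^+ 2 + (g.[t] * q) ^+ 2).
  rewrite in_itv /= => /Hn; rewrite gE -/p -/q.
  by congr (_ < _); ring.
exists (fun i j t => deform t (g.[t] * p) (g.[t] * q) (A 0 0) (A 1 0) i j); split.
- move=> i j; apply: deform_analytic => t /D0; rewrite -subr_gt0 opprK addrC.
  exact: lt0r_neq0.
- move=> t /D0 Dt; rewrite [X in Igroup t X](_ : _ =
    deform t (g.[t] * p) (g.[t] * q) (A 0 0) (A 1 0)); last first.
    by apply/matrixP => i j; rewrite mxE.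
  exact: deform_Igroup.
- apply/matrixP; apply: forall3; apply: forall3; rewrite !mxE /= ?gE ?A20 ?A21 ?A22
    ?A11 ?A01 ?addr0 ?expr1n /p /q; by field.
Qed.

Theorem proposition3p2 (R : realType) (A : 'M[R]_3) (hA : Igroup (0 : R) A) :
  coherent A <-> orientation_preserving_motion A.
Proof. by split; [exact: coherent_motion | exact: motion_coherent]. Qed.
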